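(* Let $\mathbb{F}$ be a field, $m,n\ge 0$, and let $T\subset(\mathbb{F}^m)^2\times(\mathbb{F}^n)^2$ be a linear relation. Then $T=X([\Gamma,i,j])$ for some $\mathbb{F}$-IO-network morphism $[\Gamma,i,j]:[m]\to[n]$ if and only if $T$ is Lagrangian and contains the vector $((\mathbf{1}_m,0),(\mathbf{1}_n,0))$, where $\mathbf{1}_k=(1,\dots,1)\in\mathbb{F}^k$.
   Context: $[k]$ denotes a set with $k$ elements. An $\mathbb{F}$-IO-network morphism $[\Gamma,i,j]:P\to Q$ between finite sets is a finite undirected multigraph with vertex set $V$, oriented edges $E$ (endpoints $e_\pm$, reverse $\overline e$), weights $w:E\to\mathbb{F}\setminus\{0\}$ with $w(e)=w(\overline e)$, and injective maps $i:P\to V$, $j:Q\to V$. $X([\Gamma,i,j])\subset(\mathbb{F}^P)^2\times(\mathbb{F}^Q)^2$ is the set of $((x_1,x_2),(y_1,y_2))$ such that there exists $u:V\to\mathbb{F}$ with $u(i(p))=x_1(p)$, $u(j(q))=y_1(q)$ and, for all $v\in V$, $\Delta u(v)=\sum_{q:j(q)=v}y_2(q)-\sum_{p:i(p)=v}x_2(p)$, where $\Delta u(v)=\sum_{e:e_+=v}w(e)(u(e_+)-u(e_-))$. Symplectic structure: the standard symplectic form on $\mathbb{F}^k\times\mathbb{F}^k$ is $\omega_k((x_1,x_2),(y_1,y_2))=\langle x_2,y_1\rangle-\langle x_1,y_2\rangle$ with $\langle a,b\rangle=\sum a_lb_l$. On $(\mathbb{F}^m)^2\times(\mathbb{F}^n)^2$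 use $\omega((v,w),(v',w'))=\omega_m(v,v')-\omega_n(w,w')$. A subspace is Lagrangian if $\omega$ vanishes on it and its dimension is half the ambient dimension, here $m+n$. *)

(* Defs.v *)
From HB Require Import structures.
From mathcomp Require Import all_boot all_order all_algebra.

Set Implicit Arguments.
Unset Strict Implicit.
Unset Printing Implicit Defensive.

Import GRing.Theory.
Local Open Scope ring_scope.

(* A representative (Γ, i, j) of an F-IO-network morphism P -> Q. An undirected
   edge is a pair {e, erev e} of distinct opposite oriented edges; loops and
   parallel edges are allowed, and Γ may be empty or disconnected. The images
   of P and Q in V may overlap. *)
Record io_network (F : fieldType) (P Q : finType) := IONetwork {
  vertex : finType;
  edge : finType;
  head : edge -> vertex;  (* e_+ *)
  tail : edge -> vertex;  (* e_- *)
  erev : edge -> edge;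
  weight : edge -> F;
  inp : P -> vertex;      (* i *)
  out : Q -> vertex;      (* j *)
  erevK : involutive erev;
  erev_neq : forall e, erev e != e;
  head_rev : forall e, head (erev e) = tail e;
  tail_rev : forall e, tail (erev e) = head e;
  weight_neq0 : forall e, weight e != 0;
  weight_rev : forall e, weight (erev e) = weight e;
  inp_inj : injective inp;
  out_inj : injective out
}.

Definition laplacian (F : fieldType) (P Q : finType) (N : io_network F P Q)
    (u : vertex N -> F) (v : vertex N) : F :=
  \sum_(e | head e == v) weight e * (u (head e) - u (tail e)).

(* F^o is F seen as a vector space over itself, which makes F^P and the
   products below finite-dimensional vector spaces. *)
Notation fspace F P := {ffun P -> F^o}.
Notation relspace F P Q :=
  ((fspace F P * fspace F P) * (fspace F Q * fspace F Q))%type.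

Definition io_relation (F : fieldType) (P Q : finType) (N : io_network F P Q)
    (z : relspace F P Q) : Prop :=
  let: ((x1, x2), (y1, y2)) := z in
  exists u : vertex N -> F,
    [/\ forall p, u (inp N p) = x1 p,
        forall q, u (out N q) = y1 q
      & forall v, laplacian u v =
          \sum_(q | out N q == v) y2 q - \sum_(p | inp N p == v) x2 p].

Definition dot (F : fieldType) (P : finType) (a b : fspace F P) : F :=
  \sum_p a p * b p.

Definition omega_std (F : fieldType) (P : finType)
    (x y : fspace F P * fspace F P) : F :=
  dot x.2 y.1 - dot x.1 y.2.

Definition omega_rel (F : fieldType) (P Q : finType)
    (z z' : relspace F P Q) : F :=
  omega_std z.1 z'.1 - omega_std z.2 z'.2.

Definition lagrangian (F : fieldType) (V : vectType F) (omega : V -> V -> F)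
    (T : {vspace V}) : Prop :=
  {in T &, forall z z', omega z z' = 0} /\ (\dim T).*2 = \dim {: V}.

Lemma dim_relspace (F : fieldType) (m n : nat) :
  \dim {: relspace F 'I_m 'I_n} = (m + n).*2.
Proof.
rewrite dimvf.
have -> : dim (relspace F 'I_m 'I_n)
    = ((#|'I_m| * 1 + #|'I_m| * 1) + (#|'I_n| * 1 + #|'I_n| * 1))%N by [].
by rewrite !card_ord !muln1 !addnn -doubleD.
Qed.

Definition ones (F : fieldType) (P : finType) : fspace F P := [ffun=> 1].

(* Main.v *)
Require Import Defs.
From HB Require Import structures.
From mathcomp Require Import all_boot all_order all_algebra.
From mathcomp Require Import ring.

Set Implicit Arguments.
Unset Strict Implicit.
Unset Printing Implicit Defensive.

Import GRing.Theory VectorInternalTheory.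
Local Open Scope ring_scope.

(** With [B = P + Q], [phi = (x1, y1)] and [f = (- x2, y2)], the relation of a
    network becomes [{(phi, f) | exists u, u = phi on B, Delta u = f}].  The
    Laplacian is symmetric, so this set is isotropic, and the Fredholm
    alternative for the linear system in [u] shows that it contains its
    omega-orthogonal; a subspace equal to its orthogonal is Lagrangian.

    Conversely, take generators [(A_l, F_l)] of a Lagrangian [T] whose sum is
    [(1, 0)], so that a vector of [T] is [phi = s A], [f = s F].  By maximality
    this amounts to [phi = s A] and [A f = (A F^T) s], with [A F^T] symmetric.
    These are the equations of a network with an interior vertex for each [s_l]
    and, for each terminal, an interior vertex of potential [phi + f]. *)

(** * Orthogonals of bilinear forms and solvability of linear systems *)

Lemma biscalar_mxE (F : fieldType) (V : vectType F) (f : {biscalar V}) (x y : V) :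
  f x y = (v2r x *m (\matrix_(i, j)
             f (r2v (delta_mx 0 i)) (r2v (delta_mx 0 j))) *m (v2r y)^T) 0 0.
Proof.
have expand z : z = \sum_i v2r z 0 i *: r2v (delta_mx 0 i).
  apply: (can_inj v2rK); rewrite linear_sum [LHS]row_sum_delta.
  by apply: eq_bigr => i _; rewrite linearZ /= r2vK.
rewrite {1}[y]expand linear_sumr mxE; apply: eq_bigr => j _.
rewrite linearZr_LR /= {1}[x]expand linear_sumlz mulrC !mxE; congr (_ * _).
by apply: eq_bigr => i _; rewrite mxE linearZl_LR.
Qed.

(** In coordinates the orthogonal is the left kernel of [M *m (vs2mx T)^T], with [M] the Gram
    matrix. Nondegeneracy makes [M] invertible, so this product has the rank of [T], and
    rank-nullity gives the dimension. *)
Lemma orthogonal_subspace (F : fieldType) (V : vectType F) (f : {biscalar V})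
    (T : {vspace V}) :
  (forall x, (forall y, f x y = 0) -> x = 0) ->
  {W : {vspace V} | forall x, x \in W <-> {in T, forall y, f x y = 0}
                  & (\dim W + \dim T)%N = \dim {: V}}.
Proof.
move=> f_nd.
set M := \matrix_(i, j) f (r2v (delta_mx 0 i)) (r2v (delta_mx 0 j)).
have fE x y : f x y = (v2r x *m M *m (v2r y)^T) 0 0 by apply: biscalar_mxE.
have M_free : row_free M.
  rewrite -kermx_eq0; apply/eqP/row_matrixP=> i; rewrite row0.
  have /sub_kermxP riM := row_sub i (kermx M).
  apply: (can_inj r2vK); rewrite linear0; apply: f_nd => y.
  by rewrite fE r2vK riM mul0mx mxE.
exists (mx2vs (kermx (M *m (vs2mx T)^T))) => [x|].
  rewrite memvE /subsetv !genmxE; split.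
    move/sub_kermxP=> xT0 y; rewrite memvE /subsetv genmxE => /submxP[c yE].
    by rewrite fE yE trmx_mul mulmxA -(mulmxA _ M) xT0 mul0mx mxE.
  move=> xT0; apply/sub_kermxP; rewrite mulmxA; apply/rowP=> j.
  have := xT0 (r2v (row j (vs2mx T))).
  rewrite memvE /subsetv genmxE r2vK row_sub => /(_ isT).
  rewrite fE r2vK tr_row !mxE => H; rewrite -[RHS]H.
  by apply: eq_bigr => k _; rewrite !mxE.
rewrite /dimv mxrank_gen mxrank_ker -mxrank_tr trmx_mul trmxK.
rewrite mxrankMfree ?subnK ?rank_leq_col //.
  by rewrite mxrank_gen mxrank1.
by rewrite /row_free mxrank_tr.
Qed.

(** Isotropy places [T] inside its orthogonal, and the two dimensions add up to that of [V], so half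
    dimension means equality. This replaces dimension counts by a maximality property in both
    directions of the theorem. *)
Lemma lagrangianP (F : fieldType) (V : vectType F) (f : {biscalar V})
    (T : {vspace V}) :
  (forall x, (forall y, f x y = 0) -> x = 0) ->
  lagrangian f T <-> (forall x, x \in T <-> {in T, forall y, f x y = 0}).
Proof.
move=> f_nd; have [W memW dimW] := orthogonal_subspace T f_nd.
split=> [[T_iso dimT] x|memT].
  have sTW : (T <= W)%VS by apply/subvP=> y Ty; apply/memW=> z; apply: T_iso.
  suff eTW : T = W by rewrite {1}eTW; apply: memW.
  apply/eqP; rewrite eqEdim sTW /=.
  by rewrite -(leq_add2r (\dim T)) dimW -dimT addnn.
have eTW : T = W.
  by apply/vspaceP=> x; apply/idP/idP => [/memT/memW|/memW/memT].
split; first by move=> x y /memT; apply.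
by rewrite -dimW -eTW addnn.
Qed.

(** The columns of [cokermx A] are solutions [c] of the homogeneous dual system, so the hypothesis
    makes [b] vanish on them, which places [b] in the row space of [A]. *)
Lemma fredholm_alternative (F : fieldType) (I J : finType) (a : I -> J -> F)
    (b : J -> F) :
  (forall c : J -> F, (forall i, \sum_j a i j * c j = 0) ->
     \sum_j b j * c j = 0) ->
  exists u : I -> F, forall j, \sum_i u i * a i j = b j.
Proof.
move=> orth.
pose A := \matrix_(i < #|I|, j < #|J|) a (enum_val i) (enum_val j).
pose B := \row_(j < #|J|) b (enum_val j).
have sum_enum (K : finType) (h : K -> F) :
    \sum_k h k = \sum_(k < #|K|) h (enum_val k).
  by rewrite -big_enum_val.
have /submxP[u uA] : (B <= A)%MS.
  rewrite submxE; apply/eqP/rowP => k; rewrite !mxE.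
  rewrite -[RHS](orth (fun j => cokermx A (enum_rank j) k)) => [|i].
    by rewrite [RHS]sum_enum; apply: eq_bigr => j _; rewrite mxE enum_valK.
  have /matrixP/(_ (enum_rank i) k) := mulmx_coker A.
  rewrite !mxE => H; rewrite -[RHS]H [LHS]sum_enum; apply: eq_bigr => j _.
  by rewrite !mxE enum_rankK enum_valK.
exists (fun i => u 0 (enum_rank i)) => j; rewrite sum_enum.
have /rowP/(_ (enum_rank j)) := uA; rewrite !mxE enum_rankK => ->.
by apply: eq_bigr => i _; rewrite !mxE enum_rankK enum_valK.
Qed.

(** * Boundary potentials and inflows as coordinates on the relation space *)

Definition terminal (F : fieldType) (P Q : finType) (N : io_network F P Q)
    (b : P + Q) : vertex N :=
  match b with inl p => inp N p | inr q => out N q end.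

Definition potential (F : fieldType) (P Q : finType) (b : P + Q)
    (z : relspace F P Q) : F^o :=
  match b with inl p => z.1.1 p | inr q => z.2.1 q end.

(** The sign on the input side lets inputs and outputs enter the Laplacian equation alike. *)
Definition inflow (F : fieldType) (P Q : finType) (b : P + Q)
    (z : relspace F P Q) : F^o :=
  match b with inl p => - z.1.2 p | inr q => z.2.2 q end.

Fact potential_is_linear (F : fieldType) (P Q : finType) (b : P + Q) :
  linear (@potential F P Q b).
Proof. by case: b => [p|q] a x y; rewrite /= !ffunE. Qed.

Fact inflow_is_linear (F : fieldType) (P Q : finType) (b : P + Q) :
  linear (@inflow F P Q b).
Proof.
by case: b => [p|q] a x y; rewrite /= !ffunE //= opprD scalerN.
Qed.

HB.instance Definition _ (F : fieldType) (P Q : finType) (b : P + Q) :=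
  GRing.isLinear.Build F (relspace F P Q) F^o _ (@potential F P Q b)
    (@potential_is_linear F P Q b).

HB.instance Definition _ (F : fieldType) (P Q : finType) (b : P + Q) :=
  GRing.isLinear.Build F (relspace F P Q) F^o _ (@inflow F P Q b)
    (@inflow_is_linear F P Q b).

Lemma relspace_eq (F : fieldType) (P Q : finType) (z z' : relspace F P Q) :
  (forall b, potential b z = potential b z') ->
  (forall b, inflow b z = inflow b z') -> z = z'.
Proof.
move: z z' => [[x1 x2] [y1 y2]] [[x1' x2'] [y1' y2']] ez fz.
congr (_, _, (_, _)); apply/ffunP => i.
- exact: ez (inl i).
- by apply: oppr_inj; apply: fz (inl i).
- exact: ez (inr i).
- exact: fz (inr i).
Qed.

(** The sign in [inflow] absorbs the opposite signs of the two standard forms, leaving one canonical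
    symplectic form indexed by [P + Q]. *)
Lemma omega_relE (F : fieldType) (P Q : finType) (z z' : relspace F P Q) :
  omega_rel z z' =
  \sum_b (potential b z : F) * inflow b z' - \sum_b (inflow b z : F) * potential b z'.
Proof.
rewrite !big_sumType /omega_rel /omega_std /dot /=.
under [in RHS]eq_bigr => p _ do rewrite mulrN.
under [in X in _ = _ - X]eq_bigr => p _ do rewrite mulNr.
rewrite !sumrN; ring.
Qed.

Fact omega_rel_is_bilinear (F : fieldType) (P Q : finType) :
  bilinear_for
    (GRing.Scale.Law.clone _ _ *%R _) (GRing.Scale.Law.clone _ _ *%R _)
    (@omega_rel F P Q).
Proof.
have potP b a x y :
    potential b (a *: x + y : relspace F P Q) = a * potential b x + potential b y :> F.
  exact: linearP.
have infP b a x y :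
    inflow b (a *: x + y : relspace F P Q) = a * inflow b x + inflow b y :> F.
  exact: linearP.
have distl (a p1 p2 f1 f2 p f : F) : (a * p1 + p2) * f - (a * f1 + f2) * p =
    a * (p1 * f - f1 * p) + (p2 * f - f2 * p) by ring.
have distr (a p1 p2 f1 f2 p f : F) : p * (a * f1 + f2) - f * (a * p1 + p2) =
    a * (p * f1 - f * p1) + (p * f2 - f * p2) by ring.
split=> [z'|z] a x y /=; rewrite !omega_relE -!sumrB mulr_sumr -big_split;
  by apply: eq_bigr => b _; rewrite potP infP ?distl ?distr.
Qed.

HB.instance Definition _ (F : fieldType) (P Q : finType) :=
  bilinear_isBilinear.Build F (relspace F P Q) (relspace F P Q) F _ _
    (@omega_rel F P Q) (@omega_rel_is_bilinear F P Q).

Definition relvec (F : fieldType) (P Q : finType) (phi f : P + Q -> F) :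
    relspace F P Q :=
  (([ffun p => phi (inl p)], [ffun p => - f (inl p)]),
   ([ffun q => phi (inr q)], [ffun q => f (inr q)])).

Lemma potential_relvec (F : fieldType) (P Q : finType) (phi f : P + Q -> F) b :
  potential b (relvec phi f) = phi b.
Proof. by case: b => i; rewrite /= ffunE. Qed.

Lemma inflow_relvec (F : fieldType) (P Q : finType) (phi f : P + Q -> F) b :
  inflow b (relvec phi f) = f b.
Proof. by case: b => i; rewrite /= ffunE ?opprK. Qed.

Lemma sum_delta (F : pzRingType) (B : finType) (b : B) (h : B -> F) :
  \sum_c (c == b)%:R * h c = h b.
Proof.
rewrite (bigD1 b) //= eqxx mul1r big1 ?addr0 // => c /negPf ->.
exact: mul0r.
Qed.

(** Pairing with a unit inflow at [b] reads off the potential at [b]; pairing with a unit potential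
    reads off minus the inflow. *)
Lemma omega_rel_nondegenerate (F : fieldType) (P Q : finType)
    (z : relspace F P Q) :
  (forall z', omega_rel z z' = 0) -> z = 0.
Proof.
move=> z0; apply: relspace_eq => b; rewrite linear0.
  have := z0 (relvec (fun=> 0) (fun c => (c == b)%:R)).
  rewrite omega_relE.
  under eq_bigr do rewrite inflow_relvec mulrC.
  rewrite sum_delta big1 ?subr0 // => c _.
  by rewrite potential_relvec mulr0.
have := z0 (relvec (fun c => (c == b)%:R) (fun=> 0)).
rewrite omega_relE big1 => [|c _]; last by rewrite inflow_relvec mulr0.
under eq_bigr do rewrite potential_relvec mulrC.
by rewrite sum_delta sub0r => /eqP; rewrite oppr_eq0 => /eqP.
Qed.

(** * The relation of a network is its own orthogonal *)

Lemma io_relationE (F : fieldType) (P Q : finType) (N : io_network F P Q) z :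
  io_relation N z <->
  exists u : vertex N -> F, (forall b, u (terminal N b) = potential b z) /\
    forall v, laplacian u v = \sum_(b | terminal N b == v) (inflow b z : F).
Proof.
case: z => [[x1 x2] [y1 y2]].
have sumE v : \sum_(b | terminal N b == v) (inflow b (x1, x2, (y1, y2)) : F) =
    \sum_(q | out N q == v) y2 q - \sum_(p | inp N p == v) x2 p.
  by rewrite big_sumType /= sumrN addrC.
split=> [[u [ux uy lapu]]|[u [uz lapu]]]; exists u.
  by split=> [[p|q]|v]; rewrite ?ux ?uy ?sumE.
by split=> [p|q|v]; rewrite ?lapu ?sumE //; [apply: (uz (inl p))|apply: (uz (inr q))].
Qed.

Lemma laplacian_sum (F : fieldType) (P Q : finType) (N : io_network F P Q)
    (u h : vertex N -> F) :
  \sum_v laplacian u v * h v =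
  \sum_(e : edge N) weight e * (u (Defs.head e) - u (tail e)) * h (Defs.head e).
Proof.
rewrite (partition_big (@Defs.head F P Q N) xpredT) //=; apply: eq_bigr => v _.
by rewrite mulr_suml; apply: eq_bigr => e /eqP ->.
Qed.

Lemma laplacian_symm (F : fieldType) (P Q : finType) (N : io_network F P Q)
    (u h : vertex N -> F) :
  \sum_v laplacian u v * h v = \sum_v u v * laplacian h v.
Proof.
under [RHS]eq_bigr do rewrite mulrC.
rewrite !laplacian_sum; apply/eqP; rewrite -subr_eq0 -sumrB.
(* The diagonal terms cancel, and edge reversal exchanges the two cross sums. *)
have -> : \sum_(e : edge N) (weight e * (u (Defs.head e) - u (tail e)) * h (Defs.head e)
    - weight e * (h (Defs.head e) - h (tail e)) * u (Defs.head e)) =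
  \sum_(e : edge N) weight e * u (Defs.head e) * h (tail e) -
  \sum_(e : edge N) weight e * u (tail e) * h (Defs.head e).
  by rewrite -sumrB; apply: eq_bigr => e _; ring.
rewrite subr_eq0; apply/eqP; rewrite (reindex_inj (inv_inj (@erevK F P Q N))).
by apply: eq_bigr => e _; rewrite weight_rev head_rev tail_rev.
Qed.

Lemma sum_terminal (F : fieldType) (P Q : finType) (N : io_network F P Q)
    (g : P + Q -> F) (h : vertex N -> F) :
  \sum_v (\sum_(b | terminal N b == v) g b) * h v =
  \sum_b g b * h (terminal N b).
Proof.
rewrite [RHS](partition_big (@terminal F P Q N) xpredT) //=.
by apply: eq_bigr => v _; rewrite mulr_suml; apply: eq_bigr => b /eqP ->.
Qed.

(** Green's identity: each boundary sum of inflows of one vector against potentials of the other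
    equals a sum over all vertices pairing one potential with the Laplacian of the other, and
    symmetry of the Laplacian equates the two. *)
Lemma io_relation_isotropic (F : fieldType) (P Q : finType)
    (N : io_network F P Q) z z' :
  io_relation N z -> io_relation N z' -> omega_rel z z' = 0.
Proof.
move=> /io_relationE[u [uz lapu]] /io_relationE[u' [uz' lapu']].
rewrite omega_relE; apply/eqP; rewrite subr_eq0; apply/eqP; symmetry.
under eq_bigr do rewrite -uz'.
rewrite -sum_terminal; under eq_bigr do rewrite -lapu.
rewrite laplacian_symm; under eq_bigr do rewrite lapu' mulrC.
by rewrite sum_terminal; apply: eq_bigr => b _; rewrite uz mulrC.
Qed.

(** This is linearity in [u], obtained from symmetry: both sides pair [u] with the Laplacian of the
    delta function at [v]. *)
Lemma laplacian_delta (F : fieldType) (P Q : finType) (N : io_network F P Q)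
    (u : vertex N -> F) (v : vertex N) :
  \sum_i u i * laplacian (fun x => (x == i)%:R) v = laplacian u v.
Proof.
have delta_symm i :
    laplacian (fun x => (x == i)%:R) v = laplacian (fun x => (x == v)%:R) i.
  rewrite -[LHS](sum_delta v (fun w => laplacian (fun x => (x == i)%:R) w)).
  under eq_bigr do rewrite mulrC.
  by rewrite laplacian_symm sum_delta.
under eq_bigr do rewrite delta_symm.
rewrite -laplacian_symm; under eq_bigr do rewrite mulrC.
exact: sum_delta.
Qed.

(** The unknown [u] must satisfy one Laplace equation per vertex and one boundary value per
    terminal. A dual solution [(g, k)] says that the Laplacian of [g] is minus the sum of [k] over
    the terminals at each vertex, so [g] on the terminals with inflow [- k] lies in the relation.
    Orthogonality of [z] to that vector is exactly the solvability condition. *)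
Lemma io_relation_maximal (F : fieldType) (P Q : finType)
    (N : io_network F P Q) z :
  (forall z', io_relation N z' -> omega_rel z z' = 0) -> io_relation N z.
Proof.
move=> z_orth; apply/io_relationE.
pose a (i : vertex N) (j : vertex N + (P + Q)) : F :=
  match j with
  | inl v => laplacian (fun x => (x == i)%:R) v
  | inr b => (i == terminal N b)%:R
  end.
pose rhs (j : vertex N + (P + Q)) : F :=
  match j with
  | inl v => \sum_(b | terminal N b == v) inflow b z
  | inr b => potential b z
  end.
have [c ac0|u uP] := fredholm_alternative (a := a) (b := rhs).
  pose g v := c (inl v); pose k b := c (inr b).
  have z'N : io_relation N (relvec (g \o terminal N) (fun b => - k b)).
    apply/io_relationE; exists g; split=> [b|v].
      by rewrite potential_relvec.
    have := ac0 v; rewrite big_sumType /= laplacian_symm sum_delta.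
    move/eqP; rewrite addr_eq0 => /eqP ->; rewrite -sumrN [RHS]big_mkcond /=.
    apply: eq_bigr => b _; rewrite eq_sym inflow_relvec.
    by case: eqP => _; rewrite ?mul1r // mul0r oppr0.
  have := z_orth _ z'N; rewrite omega_relE.
  under eq_bigr do rewrite inflow_relvec mulrN.
  under [X in _ - X]eq_bigr do rewrite potential_relvec /=.
  rewrite sumrN -opprD => /eqP; rewrite oppr_eq0 => /eqP H.
  rewrite -[RHS]H big_sumType addrC; congr (_ + _).
  exact: (sum_terminal (fun b => inflow b z : F) g).
exists u; split=> [b|v].
  rewrite -[RHS](uP (inr b)) /=; under eq_bigr do rewrite mulrC.
  by rewrite sum_delta.
by rewrite -[RHS](uP (inl v)) /= laplacian_delta.
Qed.

(** * Construction of a network for a Lagrangian relation *)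

Lemma weighted_graph_network (F : fieldType) (P Q V : finType) (w : V -> V -> F)
    (t : P + Q -> V) :
  (forall x y, w x y = w y x) -> injective t ->
  exists N : io_network F P Q, forall z : relspace F P Q, io_relation N z <->
    exists u : V -> F, (forall b, u (t b) = potential b z) /\
      forall v, \sum_x w v x * (u v - u x) =
        \sum_(b | t b == v) (inflow b z : F).
Proof.
move=> w_sym t_inj.
(* Zero weights are forbidden on edges, and a diagonal pair would be its own reverse. Dropping these
   pairs leaves the Laplacian unchanged, since each contributes a zero term. *)
pose is_edge := [pred e : V * V | (e.1 != e.2) && (w e.1 e.2 != 0)].
have rev_edge (e : {e | is_edge e}) : is_edge ((val e).2, (val e).1).
  by case: e => [[x y] /= e_xy]; rewrite eq_sym w_sym.
pose rev (e : {e | is_edge e}) : {e | is_edge e} := Sub _ (rev_edge e).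
have revK : involutive rev by move=> e; apply: val_inj; case: e => [[x y] ?].
have rev_neq e : rev e != e.
  case: e => [[x y] /= e_xy]; rewrite -val_eqE /= xpair_eqE.
  by rewrite [y == x]eq_sym; case/andP: (e_xy) => /negPf ->.
have w_neq0 (e : {e | is_edge e}) : w (val e).1 (val e).2 != 0.
  by case/andP: (valP e).
pose N := @IONetwork F P Q V {e | is_edge e}
  (fun e => (val e).1) (fun e => (val e).2) rev (fun e => w (val e).1 (val e).2)
  (fun p => t (inl p)) (fun q => t (inr q)) revK rev_neq (fun=> erefl)
  (fun=> erefl) w_neq0 (fun=> w_sym _ _)
  (inj_comp t_inj inl_inj) (inj_comp t_inj inr_inj).
have lapE (u : V -> F) v :
    @laplacian F P Q N u v = \sum_x w v x * (u v - u x).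
  rewrite /laplacian /=.
  rewrite -(big_sub_cond is_edge [pred e : V * V | e.1 == v]
    (fun e => w e.1 e.2 * (u e.1 - u e.2))) /=.
  rewrite (eq_bigl (fun e : V * V => (e.1 == v) && is_edge e)); last first.
    by move=> e; rewrite andbC.
  rewrite -(pair_big_dep (pred1 v) (fun x y => is_edge (x, y))
    (fun x y => w x y * (u x - u y))) /= big_pred1_eq big_mkcond /=.
  apply: eq_bigr => x _; case: eqVneq => [->|_] /=; first by rewrite subrr mulr0.
  by case: eqP => //= ->; rewrite mul0r.
have tE b : @terminal F P Q N b = t b by case: b.
exists N => z; apply: iff_trans (io_relationE _ _) _.
split=> -[u [uz lapu]]; exists u; split=> [b|v].
- by rewrite -tE.
- by rewrite -lapE lapu; apply: eq_bigl => b; rewrite tE.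
- by rewrite tE.
- by rewrite lapE lapu; apply: eq_bigl => b; rewrite tE.
Qed.

(* The graph of the quadratic form [s G s / 2 + <mu - phi, phi - s A>] in
   auxiliary potentials [s] and [mu]: stationarity in [mu] gives [phi = s A],
   and then [mu - phi] is the inflow.  Constants lie in its kernel because the
   rows of [A] sum to 1 and those of [G] to 0. *)
Lemma generators_network (F : fieldType) (P Q I : finType)
    (A f : I -> P + Q -> F) :
  (forall b, \sum_l A l b = 1) -> (forall b, \sum_l f l b = 0) ->
  (forall l l', \sum_b A l b * f l' b = \sum_b A l' b * f l b) ->
  exists N : io_network F P Q, forall z : relspace F P Q, io_relation N z <->
    exists s : I -> F, (forall b, potential b z = \sum_l s l * A l b :> F) /\
      forall l, \sum_b A l b * inflow b z =
        \sum_l' s l' * \sum_b A l b * f l' b.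
Proof.
move=> sumA sumf G_sym.
pose G l l' := \sum_b A l b * f l' b.
have sumG l : \sum_l' G l l' = 0.
  rewrite exchange_big big1 //= => b _.
  by rewrite -mulr_sumr sumf mulr0.
(* The off-diagonal entries of a graph Laplacian are [- w], so the weights are the negated mixed
   second derivatives of the form. The diagonal entries are then fixed by the vanishing row sums.
   The first copy of [P + Q] carries the terminals [phi], the second the potentials [mu]. *)
pose w (x y : (P + Q) + I + (P + Q)) : F :=
  match x, y with
  | inl (inl b), inl (inr l) | inl (inr l), inl (inl b) => - A l b
  | inl (inl b), inr b' | inr b', inl (inl b) => - (b == b')%:R
  | inl (inr l), inl (inr l') => - G l l'
  | inl (inr l), inr b | inr b, inl (inr l) => A l b
  | _, _ => 0
  end.
have w_sym x y : w x y = w y x.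
  by move: x y => [[b|l]|b] [[b'|l']|b'] //=; rewrite /G G_sym.
have [N NP] := weighted_graph_network w_sym
  (inj_comp (@inl_inj _ (P + Q)%type) (@inl_inj (P + Q)%type I)).
exists N => z; apply: iff_trans (NP z) _.
pose phi (u : _ -> F) b : F := u (inl (inl b) : (P + Q) + I + (P + Q)).
pose s (u : _ -> F) l : F := u (inl (inr l) : (P + Q) + I + (P + Q)).
pose mu (u : _ -> F) b : F := u (inr b : (P + Q) + I + (P + Q)).
have sumV (h : (P + Q) + I + (P + Q) -> F) : \sum_x h x =
    \sum_b h (inl (inl b)) + \sum_l h (inl (inr l)) + \sum_b h (inr b).
  by rewrite 2!big_sumType.
have lap_phi u b : \sum_x w (inl (inl b)) x * (u (inl (inl b)) - u x) =
    mu u b - phi u b - phi u b + \sum_l s u l * A l b.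
  rewrite sumV /= big1 => [|b' _]; last by rewrite mul0r.
  under eq_bigr do rewrite mulNr mulrBr opprB.
  under [X in _ + X]eq_bigr => b' _ do rewrite mulNr -mulrN opprB eq_sym.
  rewrite sum_delta add0r -/(phi u b) -/(mu u b).
  rewrite (eq_bigr (fun l => s u l * A l b - A l b * phi u b)) => [|l _]; last first.
    by rewrite [s u l * _]mulrC.
  rewrite sumrB -mulr_suml sumA; ring.
have lap_mu u b : \sum_x w (inr b) x * (u (inr b) - u x) =
    phi u b - \sum_l s u l * A l b.
  rewrite sumV /= [X in _ + X]big1 => [|b' _]; last by rewrite mul0r.
  under eq_bigr => b' _ do rewrite mulNr -mulrN opprB.
  rewrite sum_delta -/(phi u b) -/(mu u b).
  rewrite (eq_bigr (fun l => A l b * mu u b - s u l * A l b)) => [|l _]; last first.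
    by rewrite mulrBr [s u l * _]mulrC.
  rewrite sumrB -mulr_suml sumA; ring.
have lap_s u l : \sum_x w (inl (inr l)) x * (u (inl (inr l)) - u x) =
    \sum_l' s u l' * G l l' - \sum_b A l b * (mu u b - phi u b).
  rewrite sumV /= -/(s u l).
  rewrite [X in _ + X + _](eq_bigr (fun l' => s u l' * G l l' - G l l' * s u l)).
    rewrite sumrB -mulr_suml sumG mul0r subr0 addrAC addrC -big_split /=.
    rewrite -sumrN; congr (_ + _); apply: eq_bigr => b _.
    rewrite -/(phi u b) -/(mu u b); ring.
  by move=> l' _; rewrite -/(s u l'); ring.
pose t b : (P + Q) + I + (P + Q) := inl (inl b).
have rhs0 y : (forall b, t b != y) -> \sum_(b | t b == y) (inflow b z : F) = 0.
  by move=> ty; rewrite big_pred0 // => b; apply/negbTE.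
have rhs_phi b : \sum_(b' | t b' == inl (inl b)) (inflow b' z : F) = inflow b z.
  by rewrite (big_pred1 b).
split=> [[u [uz lapu]]|[r [rz rf]]].
  have phiE b : phi u b = \sum_l s u l * A l b.
    apply/eqP; rewrite -subr_eq0 -lap_mu lapu; apply/eqP.
    exact: (rhs0 (inr b)).
  exists (s u); split=> [b|l]; first by rewrite -phiE -uz.
  have inflowE b : inflow b z = mu u b - phi u b :> F.
    have := lapu (inl (inl b)); rewrite lap_phi -phiE subrK => ->.
    exact/esym/rhs_phi.
  under eq_bigr do rewrite inflowE.
  apply/esym/eqP; rewrite -subr_eq0 -lap_s lapu; apply/eqP.
  exact: (rhs0 (inl (inr l))).
pose u (x : (P + Q) + I + (P + Q)) : F :=
  match x with
  | inl (inl b) => potential b z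
  | inl (inr l) => r l
  | inr b => (potential b z : F) + inflow b z
  end.
exists u; split=> // -[[b|l]|b].
- rewrite [RHS]rhs_phi; apply: etrans (lap_phi u b) _.
  by rewrite /mu /phi /s /= -rz subrK addrAC subrr add0r.
- rewrite [RHS]rhs0 //; apply: etrans (lap_s u l) _.
  rewrite /mu /phi /s /= -rf; apply/eqP; rewrite subr_eq0.
  by apply/eqP/eq_bigr => b _; rewrite addrAC subrr add0r.
- rewrite [RHS]rhs0 //; apply: etrans (lap_mu u b) _.
  by rewrite /phi /s /= -rz subrr.
Qed.

Lemma potential_inflow_sum (F : fieldType) (P Q : finType) (n : nat)
    (g : n.-tuple (relspace F P Q)) (s : 'I_n -> F) (b : P + Q) :
  (potential b (\sum_i s i *: g`_i) = \sum_i s i * (potential b g`_i : F) :> F) /\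
  (inflow b (\sum_i s i *: g`_i) = \sum_i s i * (inflow b g`_i : F) :> F).
Proof.
by split; rewrite linear_sum; apply: eq_bigr => i _; rewrite linearZ.
Qed.

Lemma lagrangian_network (F : fieldType) (P Q : finType)
    (T : {vspace relspace F P Q}) :
  lagrangian (@omega_rel F P Q) T ->
  ((ones F P, 0), (ones F Q, 0)) \in T ->
  exists N : io_network F P Q, forall z, z \in T <-> io_relation N z.
Proof.
move=> T_lagr T1; have [T_iso _] := T_lagr.
have memT := (lagrangianP T (@omega_rel_nondegenerate F P Q)).1 T_lagr.
set o := (_, _) in T1.
pose g : (\dim T).+1.-tuple (relspace F P Q) :=
  cons_tuple (o - \sum_(i < \dim T) (vbasis T)`_i) (vbasis T).
have gT (i : 'I_(\dim T).+1) : g`_i \in T.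
  case: (unliftP ord0 i) => [j ->|->] /=.
    by apply: vbasis_mem; rewrite mem_nth // size_tuple; apply: ltn_ord.
  apply: memvB => //; apply: memv_suml => j _.
  by apply: vbasis_mem; rewrite mem_nth // size_tuple; apply: ltn_ord.
have spang z : z \in T -> exists s : 'I_(\dim T).+1 -> F, z = \sum_i s i *: g`_i.
  move=> /coord_vbasis zE.
  (* The extra generator gets coefficient 0, the others their basis coordinates. *)
  exists (fun i => if unlift ord0 i is Some j then coord (vbasis T) j z else 0).
  rewrite big_ord_recl unlift_none scale0r add0r {1}zE.
  by apply: eq_bigr => j _; rewrite liftK.
have sumg : \sum_(i < (\dim T).+1) g`_i = o by rewrite big_ord_recl /= subrK.
pose A (l : 'I_(\dim T).+1) b : F := potential b g`_l.
pose f (l : 'I_(\dim T).+1) b : F := inflow b g`_l.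
have sumA b : \sum_l A l b = 1.
  rewrite -(linear_sum (@potential F P Q b)) sumg.
  by case: b => i; rewrite /= ffunE.
have sumf b : \sum_l f l b = 0.
  rewrite -(linear_sum (@inflow F P Q b)) sumg.
  by case: b => i; rewrite /= ffunE ?oppr0.
have G_sym l l' : \sum_b A l b * f l' b = \sum_b A l' b * f l b.
  have /eqP := T_iso _ _ (gT l) (gT l').
  rewrite omega_relE subr_eq0 => /eqP ->.
  by apply: eq_bigr => b _; rewrite mulrC.
have [N NP] := generators_network sumA sumf G_sym.
exists N => z; apply: iff_trans (iff_sym (NP z)); split=> [Tz|[s [zA zf]]].
  have [s zE] := spang z Tz; exists s; split=> [b|l].
    by rewrite zE (potential_inflow_sum g s b).1.
  under [RHS]eq_bigr do rewrite mulr_sumr.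
  rewrite exchange_big /=; apply: eq_bigr => b _.
  rewrite zE (potential_inflow_sum g s b).2 mulr_sumr.
  by apply: eq_bigr => l' _; rewrite mulrCA.
set z' := \sum_l s l *: (g : seq _)`_l.
have Tz' : z' \in T by apply: memv_suml => l _; apply/memvZ/gT.
have z'A b : potential b z' = potential b z by rewrite zA (potential_inflow_sum g s b).1.
(* [z] and [z'] have the same potentials, and their inflows pair equally with every row of [A].
   Hence [z - z'] is orthogonal to all generators, and maximality of [T] puts it in [T]. *)
suff Tzz' : z - z' \in T by rewrite -(subrK z' z) memvD.
apply/memT => y /spang[c ->].
rewrite linear_sumr big1 // => l _; rewrite linearZr_LR /= omega_relE.
have potB b : (potential b (z - z') : F) * inflow b g`_l = 0.
  have -> : potential b (z - z') = (potential b z : F) - potential b z'.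
    exact: (raddfB (@potential F P Q b)).
  by rewrite z'A subrr mul0r.
have infB b : (inflow b (z - z') : F) * potential b g`_l =
    A l b * inflow b z - A l b * inflow b z'.
  have -> : inflow b (z - z') = (inflow b z : F) - inflow b z'.
    exact: (raddfB (@inflow F P Q b)).
  by rewrite mulrC mulrBr.
rewrite (eq_bigr _ (fun b _ => potB b)) (eq_bigr _ (fun b _ => infB b)).
rewrite big1 // sumrB zf.
suff -> : \sum_l' s l' * \sum_b A l b * f l' b = \sum_b A l b * inflow b z'.
  by rewrite subrr subr0 mulr0.
under eq_bigr do rewrite mulr_sumr.
rewrite exchange_big /=; apply: eq_bigr => b _.
rewrite (potential_inflow_sum g s b).2 mulr_sumr.
by apply: eq_bigr => l' _; rewrite mulrCA.
Qed.

Theorem mainTheorem10 (F : fieldType) (m n : nat)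
    (T : {vspace relspace F 'I_m 'I_n}) :
  (exists N : io_network F 'I_m 'I_n, forall z, z \in T <-> io_relation N z)
  <->
  (lagrangian (@omega_rel F 'I_m 'I_n) T
   /\ ((ones F 'I_m, 0), (ones F 'I_n, 0)) \in T).
Proof.
split=> [[N TN]|[T_lagr T1]]; last exact: lagrangian_network.
split.
  apply/(lagrangianP T (@omega_rel_nondegenerate F 'I_m 'I_n)) => z.
  split=> [/TN Nz z' /TN Nz'|z_orth]; first exact: io_relation_isotropic Nz Nz'.
  by apply/TN/io_relation_maximal => z' /TN; apply: z_orth.
(* A constant potential has zero Laplacian, so it needs no inflow at the terminals. *)
apply/TN; exists (fun=> 1); split=> [p|q|v]; rewrite ?ffunE //.
rewrite /laplacian !big1 ?subr0 // => [i _|i _|e _]; rewrite ?ffunE //.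
by rewrite subrr mulr0.
Qed.
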